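(* There is a coarse proximity space $(X,\mathcal{B},\mathbf{b})$ for which $dim(\mathcal{U}X)<asInd(X)$.
   Context: Coarse proximity spaces. A bornology on a set $X$ is a family $\mathcal{B}$ of subsets of $X$ that contains all singletons, is closed under taking subsets, and is closed under unions of two members. Members of $\mathcal{B}$ are called bounded; other subsets of $X$ are unbounded. A coarse proximity space is a triple $(X,\mathcal{B},\mathbf{b})$ where $\mathcal{B}$ is a bornology on $X$ and $\mathbf{b}$ is a relation on the power set of $X$ such that for all $A,B,C\subseteq X$ (writing $\bar{\mathbf{b}}$ for the negation of $\mathbf{b}$): (1) $A\mathbf{b}B\Rightarrow B\mathbf{b}A$; (2) $A\mathbf{b}B\Rightarrow A,B\notin\mathcal{B}$; (3) $A\cap B\notin\mathcal{B}\Rightarrow A\mathbf{b}B$; (4) $(A\cup B)\mathbf{b}C\iff A\mathbf{b}C$ or $B\mathbf{b}C$; (5) $A\bar{\mathbf{b}}B\Rightarrow$ there is $E\subseteq X$ with $A\bar{\mathbf{b}}E$ and $(X\setminus E)\bar{\mathbf{b}}B$. A subset $Y\subseteq X$ carries the subspace coarse proximity structure: bornology $\{B\cap Y: B\in\mathcal{B}\}$, and $A\mathbf{b}_YC\iff A\mathbf{b}C$ for $A,C\subseteq Y$. Boundary. The discrete extension of $\mathbf{b}$ is the separated proximity $\delta$ on $X$ given by $A\delta B\iff(A\cap B\neq\emptyset$ or $A\mathbf{b}B)$. A cluster of $(X,\delta)$ is a collection $\sigma$ of nonempty subsets of $X$ such that $A\delta B$ for all $A,B\in\sigma$; if $C\delta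 A$ for all $A\in\sigma$ then $C\in\sigma$; and if $A\cup B\in\sigma$ then $A\in\sigma$ or $B\in\sigma$. The Smirnov compactification $\mathfrak{X}$ is the set of all clusters with the separated proximity $\delta^*$: $\mathcal{A}\delta^*\mathcal{C}$ iff $A\delta C$ for all $A,C\subseteq X$ such that $A\in\sigma$ for every $\sigma\in\mathcal{A}$ and $C\in\sigma$ for every $\sigma\in\mathcal{C}$. Its topology (closure of $\mathcal{A}$ is $\{\sigma:\{\sigma\}\delta^*\mathcal{A}\}$) is compact Hausdorff, and $X$ is identified with the dense set of point clusters (those containing a singleton); then $cl_{\mathfrak{X}}(A)=\{\sigma\in\mathfrak{X}:A\in\sigma\}$ for $A\subseteq X$. The boundary $\mathcal{U}X\subseteq\mathfrak{X}$ is the subspace of clusters containing no bounded set (it is compact Hausdorff). The trace of $A\subseteq X$ is $A'=cl_{\mathfrak{X}}(A)\cap\mathcal{U}X$. Dimensions. $dim$ denotes the (Lebesgue) covering dimension of a topological space. A separator between disjoint subsets $A,B$ of a topological space $T$ is a set $C\subseteq T$ such that $T\setminus C=U\cup V$ with $U,V$ disjoint open in $T$, $A\subseteq U$, $B\subseteq V$. If $A\bar{\mathbf{b}}B$ in $X$, an asymptotic separator between $A$ and $B$ is a set $C\subseteq X$ such that $C'$ is a separator in $\mathcal{U}X$ between $A'$ and $B'$. The asymptotic inductive dimension: $asInd(X)=-1$ iff $X$ is bounded; for $n\ge0$, $asInd(X)\le n$ if for all $A,B\subseteq X$ with $A\bar{\mathbf{b}}B$ there is an asymptotic separator $C\subseteq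 X$ between $A$ and $B$ with $asInd(C)\le n-1$ ($C$ with the subspace coarse proximity structure); $asInd(X)=n$ if $n\ge-1$ is the smallest integer with $asInd(X)\le n$; $asInd(X)=\infty$ if there is no such integer. *)

(* Defs.v *)
From HB Require Import structures.
From mathcomp Require Import all_boot all_order all_algebra.
From mathcomp Require Import all_classical constructive_ereal topology.
Set Implicit Arguments.
Unset Strict Implicit.
Unset Printing Implicit Defensive.
Import Order.TTheory GRing.Theory Num.Theory.
Local Open Scope classical_set_scope.
Local Open Scope card_scope.

(* [set0] is bounded as soon as [X] is inhabited; requiring it outright only
   rules out the empty family of bounded sets on an empty [X], for which the
   empty space would be unbounded. *)
Record is_bornology (X : Type) (B : set (set X)) : Prop := IsBornology {
  bornology0 : B set0;
  bornology1 : forall x, B [set x];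
  bornology_sub : forall A C, A `<=` C -> B C -> B A;
  bornologyU : forall A C, B A -> B C -> B (A `|` C) }.

Record coarse_proximity (X : Type) := CoarseProximity {
  bounded : set (set X);
  coarse_close : set X -> set X -> Prop;
  bounded_bornology : is_bornology bounded;
  close_sym : forall A B, coarse_close A B -> coarse_close B A;
  close_unbounded : forall A B, coarse_close A B -> ~ bounded A /\ ~ bounded B;
  close_meet : forall A B, ~ bounded (A `&` B) -> coarse_close A B;
  closeU : forall A B C,
    coarse_close (A `|` B) C <-> coarse_close A C \/ coarse_close B C;
  close_strong : forall A B, ~ coarse_close A B ->
    exists E, ~ coarse_close A E /\ ~ coarse_close (~` E) B }.

Section Subspace.
Context (X : Type) (P : coarse_proximity X) (Y : set X).

Let val_preimageK (B : set X) : set_val @` (set_val @^-1` B : set Y) = B `&` Y.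
Proof.
apply/seteqP; split=> [_ [y By <-]|x [Bx Yx]].
  by split=> //; exact/set_mem/(valP y).
by exists (exist _ x (mem_set Yx)).
Qed.

Definition sub_bounded : set (set Y) :=
  [set D | exists2 B, bounded P B & set_val @` D = B `&` Y].

Definition sub_close (A C : set Y) : Prop :=
  coarse_close P (set_val @` A) (set_val @` C).

Lemma sub_boundedE D : sub_bounded D <-> bounded P (set_val @` D).
Proof.
have [_ _ bS _] := bounded_bornology P; split=> [[B bB ->]|bD].
  exact: bS bB.
exists (set_val @` D) => //; apply/seteqP; split=> [_ [y Dy <-]|x []//].
by split; [exists y | exact/set_mem/(valP y)].
Qed.

Lemma sub_bornology : is_bornology sub_bounded.
Proof.
have [b0 b1 bS bU] := bounded_bornology P; split.
- by apply/sub_boundedE; rewrite image_set0.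
- by move=> x; apply/sub_boundedE; rewrite image_set1.
- move=> A C AC /sub_boundedE bC; apply/sub_boundedE; apply: bS bC.
  exact: image_subset.
- move=> A C /sub_boundedE bA /sub_boundedE bC; apply/sub_boundedE.
  by rewrite image_setU; exact: bU.
Qed.

Lemma closeS (A B C : set X) :
  A `<=` B -> coarse_close P A C -> coarse_close P B C.
Proof. by move=> /setUidPr <- AC; apply/closeU; left. Qed.

Lemma sub_close_sym A B : sub_close A B -> sub_close B A.
Proof. exact: close_sym. Qed.

Lemma sub_close_unbounded A B :
  sub_close A B -> ~ sub_bounded A /\ ~ sub_bounded B.
Proof. by move=> /close_unbounded[nA nB]; split=> /sub_boundedE. Qed.

Lemma sub_close_meet A B : ~ sub_bounded (A `&` B) -> sub_close A B.
Proof.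
have [_ _ bS _] := bounded_bornology P.
move=> nAB; apply: close_meet => bAB; apply: nAB; apply/sub_boundedE.
by apply: bS bAB; exact: sub_image_setI.
Qed.

Lemma sub_closeU A B C :
  sub_close (A `|` B) C <-> sub_close A C \/ sub_close B C.
Proof. by rewrite /sub_close image_setU; exact: closeU. Qed.

Lemma sub_close_strong A B : ~ sub_close A B ->
  exists E, ~ sub_close A E /\ ~ sub_close (~` E) B.
Proof.
move=> /close_strong[E [nAE nEB]]; exists (set_val @^-1` E).
split=> [cAE|cEB].
  apply/nAE/close_sym; apply: closeS (close_sym cAE).
  by rewrite val_preimageK; exact: subIsetl.
by apply: nEB; apply: closeS cEB => _ [y nEy <-].
Qed.

Definition subspace_proximity : coarse_proximity Y :=
  CoarseProximity sub_bornology sub_close_sym sub_close_unbounded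
    sub_close_meet sub_closeU sub_close_strong.

End Subspace.

Section Smirnov.
Context (X : Type) (P : coarse_proximity X).

Definition discrete_extension (A B : set X) : Prop :=
  A `&` B !=set0 \/ coarse_close P A B.

Local Notation delta := discrete_extension.

(* A point of the Smirnov compactification is a cluster of [(X, delta)]. *)
Record smirnov := Cluster {
  cluster_mem :> set X -> Prop;
  cluster_neq0 : forall A, cluster_mem A -> A !=set0;
  cluster_near : forall A B, cluster_mem A -> cluster_mem B -> delta A B;
  cluster_max : forall C, (forall A, cluster_mem A -> delta C A) ->
    cluster_mem C;
  clusterU : forall A B, cluster_mem (A `|` B) ->
    cluster_mem A \/ cluster_mem B }.

HB.instance Definition _ := gen_eqMixin smirnov.
HB.instance Definition _ := gen_choiceMixin smirnov.

Definition smirnov_near (F G : set smirnov) : Prop :=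
  forall A C : set X, (forall s, F s -> s A) -> (forall s, G s -> s C) ->
  delta A C.

Definition smirnov_closure (F : set smirnov) : set smirnov :=
  [set s | smirnov_near [set s] F].

Lemma delta_sym A B : delta A B -> delta B A.
Proof.
by case=> [|/close_sym]; [rewrite setIC; left | right].
Qed.

Lemma deltaU A B C : delta (A `|` B) C <-> delta A C \/ delta B C.
Proof.
split=> [[|/closeU[]]|[[|]|[|]]].
- by rewrite setIUl => -[x [ACx|BCx]]; [left|right]; left; exists x.
- by left; right.
- by right; right.
- by move=> [x [Ax Cx]]; left; exists x; split=> //; left.
- by move=> AC; right; apply/closeU; left.
- by move=> [x [Bx Cx]]; left; exists x; split=> //; right.
- by move=> BC; right; apply/closeU; right.
Qed.

Lemma deltaS A B C : A `<=` B -> delta A C -> delta B C.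
Proof. by move=> /setUidPr <- AC; apply/deltaU; left. Qed.

Lemma delta_strong A B : ~ delta A B ->
  exists E, ~ delta A E /\ ~ delta (~` E) B.
Proof.
move=> nAB; have AB0 x : A x -> ~ B x.
  by move=> Ax Bx; apply: nAB; left; exists x.
have ncAB : ~ coarse_close P A B by move=> cAB; apply: nAB; right.
have [E [nAE nEB]] := close_strong ncAB.
exists ((E `\` A) `|` B); split.
  move=> /delta_sym/deltaU[].
    case=> [[x [[_ nAx] /nAx]]//|cE].
    by apply/nAE/close_sym; apply: closeS cE; exact: subDsetl.
  by move=> /delta_sym.
have sub : ~` (E `\` A `|` B) `<=` ~` E `|` A.
  move=> x nx; have [Ax|nAx] := pselect (A x); [by right|left=> Ex].
  by apply: nx; left.
case=> [[x [nx Bx]]|/(closeS sub)/closeU[//|//]].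
by apply: nx; right.
Qed.

Lemma clusterS (s : smirnov) A B : A `<=` B -> s A -> s B.
Proof.
by move=> AB sA; apply: cluster_max => C /(cluster_near sA); exact: deltaS.
Qed.

Lemma clusterT (s : smirnov) : s setT.
Proof.
apply: cluster_max => A /cluster_neq0[x Ax]; left; by exists x.
Qed.

Lemma cluster_strong (s : smirnov) A B : s A -> ~ delta A B ->
  exists F, ~ s (~` F) /\ ~ delta F B.
Proof.
move=> sA /delta_strong[E [nAE nEB]]; exists (~` E); split=> //.
by rewrite setCK => sE; exact/nAE/cluster_near/sE.
Qed.

Lemma smirnov_closureP F (s : smirnov) :
  smirnov_closure F s <->
  forall A C, s A -> (forall t, F t -> t C) -> delta A C.
Proof.
split=> [nsF A C sA FC|nsF A C sA]; last exact: nsF (sA s erefl).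
by apply: nsF => // t ->.
Qed.

Lemma sub_smirnov_closure F : F `<=` smirnov_closure F.
Proof.
move=> s Fs; apply/smirnov_closureP => A C sA /(_ _ Fs); exact: cluster_near.
Qed.

Lemma smirnov_closureS F G :
  F `<=` G -> smirnov_closure F `<=` smirnov_closure G.
Proof.
move=> FG s /smirnov_closureP nsF; apply/smirnov_closureP => A C sA GC.
by apply: nsF => // t /FG/GC.
Qed.

Lemma smirnov_closureU F G :
  smirnov_closure (F `|` G) `<=` smirnov_closure F `|` smirnov_closure G.
Proof.
move=> s /smirnov_closureP nsFG; apply: contrapT => /not_orP[].
have far H : ~ smirnov_closure H s ->
    exists A C, [/\ s A, forall t, H t -> t C & ~ delta A C].
  move=> ns; apply: contrapT => nAC; apply/ns/smirnov_closureP => A C sA HC.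
  by apply: contrapT => nd; apply: nAC; exists A, C.
move=> /far[A1 [C1 [sA1 FC1 n1]]] /far[A2 [C2 [sA2 GC2 n2]]].
have [F1 [nF1 d1]] := cluster_strong sA1 n1.
have [F2 [nF2 d2]] := cluster_strong sA2 n2.
have sI : s (F1 `&` F2).
  have : s ((F1 `&` F2) `|` ~` (F1 `&` F2)) by rewrite setUv; exact: clusterT.
  by case/clusterU => //; rewrite setCI => /clusterU[].
have /delta_sym/deltaU[/delta_sym d|/delta_sym d] :
    delta (F1 `&` F2) (C1 `|` C2).
- apply: nsFG => // t [/FC1|/GC2]; apply: clusterS => x; [by left|by right].
- by apply: d1; apply: deltaS d; exact: subIsetl.
- by apply: d2; apply: deltaS d; exact: subIsetr.
Qed.

Lemma smirnov_closure_idem F :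
  smirnov_closure (smirnov_closure F) `<=` smirnov_closure F.
Proof.
move=> s /smirnov_closureP nsF; apply/smirnov_closureP => A C sA FC.
apply: nsF => // t /smirnov_closureP ntF; apply: cluster_max => B tB.
exact/delta_sym/ntF.
Qed.

Definition smirnov_open : set (set smirnov) :=
  [set U | smirnov_closure (~` U) `<=` ~` U].

Lemma smirnov_openT : smirnov_open setT.
Proof.
move=> s /smirnov_closureP; rewrite setCT => /(_ setT set0 (clusterT s)).
case=> // [[x []]//|/close_unbounded[_]].
by case; have [] := bounded_bornology P.
Qed.

Lemma smirnov_openI : setI_closed smirnov_open.
Proof.
move=> U V oU oV; rewrite /smirnov_open/= setCI => s /smirnov_closureU.
by case=> [/oU|/oV]; [left|right].
Qed.

Lemma smirnov_open_bigU (I : Type) (f : I -> set smirnov) :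
  (forall i, smirnov_open (f i)) -> smirnov_open (\bigcup_i f i).
Proof.
move=> of_; rewrite /smirnov_open/= => s cs [i _]; apply: of_.
by apply: smirnov_closureS cs; apply: subsetC; exact: bigcup_sup.
Qed.

HB.instance Definition _ :=
  isOpenTopological.Build smirnov smirnov_openT smirnov_openI smirnov_open_bigU.

Lemma smirnov_closureE (F : set smirnov) : closure F = smirnov_closure F.
Proof.
apply/seteqP; split.
  rewrite closureE; apply: smallest_sub; last exact: sub_smirnov_closure.
  rewrite -openC; change (smirnov_open (~` smirnov_closure F)).
  by rewrite /smirnov_open/= setCK; exact: smirnov_closure_idem.
have : open (~` closure F) by rewrite openC; exact: closed_closure.
rewrite /open/= /smirnov_open/= setCK => cF s cs; apply: cF.
by apply: smirnov_closureS cs; exact: subset_closure.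
Qed.

End Smirnov.

Arguments smirnov {X} P.

Definition boundary (X : Type) (P : coarse_proximity X) : set (smirnov P) :=
  [set s | forall B, bounded P B -> ~ s B].

Arguments boundary {X} P.

(* A point [a] of [X] is identified with the cluster containing [[set a]]. *)
Definition smirnov_cl (X : Type) (P : coarse_proximity X) (A : set X) :
  set (smirnov P) := closure [set s : smirnov P | exists2 a, A a & s [set a]].

Arguments smirnov_cl {X} P A.

Lemma close_point (X : Type) (P : coarse_proximity X) (a : X) (A : set X) :
  ~ coarse_close P A [set a].
Proof.
move=> /close_unbounded[_]; apply.
exact: bornology1 (bounded_bornology P) a.
Qed.

Lemma delta_point (X : Type) (P : coarse_proximity X) (a : X) (A : set X) :
  discrete_extension P A [set a] <-> A a.
Proof.
split=> [[[x [Ax <-]]//|cA]|Aa]; first by case: (close_point cA).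
by left; exists a.
Qed.

Definition point_cluster (X : Type) (P : coarse_proximity X) (a : X) :
  smirnov P.
Proof.
apply: (@Cluster X P [set A | A a]).
- by move=> A Aa; exists a.
- by move=> A B Aa Ba; left; exists a.
- by move=> C /(_ [set a] erefl)/delta_point.
- by [].
Defined.

Lemma smirnov_clE (X : Type) (P : coarse_proximity X) (A : set X) :
  smirnov_cl P A = [set s : smirnov P | s A].
Proof.
rewrite /smirnov_cl smirnov_closureE; apply/seteqP; split=> s /=.
  move=> /smirnov_closureP nA; apply: cluster_max => B sB.
  apply/delta_sym/nA => // t [a Aa]; apply: clusterS.
  by move=> _ ->.
move=> sA; apply/smirnov_closureP => D E sD AE.
have sAE : A `<=` E.
  move=> a Aa; have : (point_cluster P a) E by apply: AE; exists a.
  by [].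
exact: delta_sym (deltaS sAE (delta_sym (cluster_near sD sA))).
Qed.

Definition trace (X : Type) (P : coarse_proximity X) (A : set X) :
  set (boundary P) := set_val @^-1` smirnov_cl P A.

Arguments trace {X} P A.

Definition separator (T : topologicalType) (A B C : set T) : Prop :=
  exists U V : set T, [/\ open U, open V, U `&` V = set0,
    ~` C = U `|` V & A `<=` U /\ B `<=` V].

Definition asymptotic_separator (X : Type) (P : coarse_proximity X)
  (A B C : set X) : Prop := separator (trace P A) (trace P B) (trace P C).

(* Dimensions start at -1: [asInd_le k P] means [asInd <= k - 1], and
   [covering_dim_le k T] means [dim <= k - 1]. *)
Fixpoint asInd_le (k : nat) (X : Type) (P : coarse_proximity X) : Prop :=
  if k is k'.+1 then
    forall A B : set X, ~ coarse_close P A B ->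
      exists C : set X, asymptotic_separator P A B C /\
        asInd_le k' (subspace_proximity P C)
  else bounded P setT.

Definition open_cover (T : topologicalType) (U : set (set T)) : Prop :=
  (forall W, U W -> open W) /\ \bigcup_(W in U) W = setT.

Definition covering_dim_le (k : nat) (T : topologicalType) : Prop :=
  forall U : set (set T), finite_set U -> open_cover U ->
    exists V : set (set T), [/\ finite_set V, open_cover V,
      forall W, V W -> exists2 W', U W' & W `<=` W' &
      forall x, [set W | V W /\ W x] #<= `I_k].

Definition least_dimension (le : nat -> Prop) : \bar int :=
  xget +oo%E [set ((k%:Z - 1)%R)%:E
    | k in [set k | le k /\ forall j, le j -> (k <= j)%N]].

Definition covering_dim (T : topologicalType) : \bar int :=
  least_dimension (fun k => covering_dim_le k T).

Definition asInd (X : Type) (P : coarse_proximity X) : \bar int :=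
  least_dimension (fun k => asInd_le k P).

(* Main.v *)
Require Import Defs.
From mathcomp Require Import all_boot all_order all_algebra.
From mathcomp Require Import all_classical constructive_ereal topology.
From mathcomp Require Import reals interval_inference normedtype Rstruct.
Set Implicit Arguments.
Unset Strict Implicit.
Unset Printing Implicit Defensive.
Import Order.TTheory GRing.Theory Num.Theory.
Local Open Scope classical_set_scope.

(** An asymptotic separator must be the trace of a subset of the space, so the
    asymptotic inductive dimension can be made infinite by a boundary of small
    dimension with very few traces.  The example is the unit interval whose
    bounded sets are its nowhere dense subsets.

    For any compact Hausdorff space T and any ideal I of subsets containing the
    points, let A^* be the set of points near which A is not in I.  Declaring A
    bounded when A^* is empty, and A, B close when A^* meets B^*, gives a coarse
    proximity on T ([ideal_proximity]).  If no nonempty open set is in I, then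
    t |-> {A | t in A^*} is a homeomorphism from T onto the boundary, which
    carries A^* to the trace of A.  So the boundary inherits the covering
    dimension of T ([boundary_covering_dim]), which is at most 1 for the unit
    interval ([unit_interval_covering_dim]).

    Now let I consist of the nowhere dense sets, and let T be locally connected
    without isolated points.  A subset that is not nowhere dense is dense in
    some nonempty connected open set J, and then its trace contains J.  Two
    disjoint closed pieces of J with nonempty interior cannot be separated by
    the empty set inside such a trace.  Hence every separator C between the
    corresponding subsets is unbounded, that is, again not nowhere dense, and
    the same argument applies to C.  By induction on k no unbounded subset of T
    satisfies asInd <= k ([not_asInd_le]), so asInd T is infinite.

    A subspace of a subspace is a type of its own, no longer a subset of T.  The
    induction therefore runs over all coarse proximity spaces X with a map
    f : X -> T that pulls the structure of T back to X ([modelled]). *)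

(** * Local functions of an ideal *)

(** Kuratowski's local function A^* of the ideal [I]. *)
Definition local_function (T : topologicalType) (I : set (set T)) (A : set T) :
  set T := [set t | forall U, nbhs t U -> ~ I (A `&` U)].

Section LocalFunction.
Context (T : topologicalType) (I : set (set T)) (bI : is_bornology I).

Local Notation lf := (local_function I).

Lemma not_local_function A t :
  ~ lf A t -> exists2 U, open_nbhs t U & I (A `&` U).
Proof.
move=> nA; apply: contrapT => nU; apply: nA => U; rewrite nbhsE => -[V oV VU].
move=> IU; apply: nU; exists V => //.
by apply: bornology_sub bI _ _ _ IU; exact: setIS.
Qed.

Lemma local_functionS A B : A `<=` B -> lf A `<=` lf B.
Proof.
move=> AB t At U tU IU; apply: At tU _.
by apply: bornology_sub bI _ _ _ IU; exact: setSI.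
Qed.

Lemma local_function0 : lf set0 = set0.
Proof.
apply/seteqP; split=> // t /(_ setT filterT); rewrite set0I; apply.
exact: bornology0 bI.
Qed.

Lemma local_functionU A B : lf (A `|` B) = lf A `|` lf B.
Proof.
apply/seteqP; split=> [t ABt|t [|]]; last 2 first.
- by apply: local_functionS; exact: subsetUl.
- by apply: local_functionS; exact: subsetUr.
apply: contrapT => /not_orP[/not_local_function[U [oU Ut] IU]].
move=> /not_local_function[V [oV Vt] IV]; apply: (ABt (U `&` V)).
  by apply: filterI; apply: open_nbhs_nbhs.
apply: bornology_sub bI _ _ _ (bornologyU bI IU IV).
by move=> x [[Ax|Bx] [Ux Vx]]; [left|right].
Qed.

Lemma local_function1 x : lf [set x] = set0.
Proof.
apply/seteqP; split=> // t /(_ setT filterT); rewrite setIT; apply.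
exact: bornology1 bI x.
Qed.

Lemma local_function_closure A : lf A `<=` closure A.
Proof.
move=> t At U tU; apply/set0P/eqP => AU; apply: At tU _.
by rewrite AU; exact: bornology0 bI.
Qed.

Lemma closed_local_function (A : set T) : closed (lf A).
Proof.
move=> t ct U; rewrite nbhsE => -[V [oV Vt] VU] IU.
have [u [Au Vu]] := ct V (open_nbhs_nbhs (conj oV Vt)).
apply: Au (open_nbhs_nbhs (conj oV Vu)) _.
by apply: bornology_sub bI _ _ _ IU; exact: setIS.
Qed.

(** The local function of a set at [t] depends only on the set near [t]. *)
Lemma local_functionD A U t : nbhs t U -> ~ lf (A `\` U) t.
Proof.
move=> tU /(_ _ tU); rewrite setDE -setIA setICl setI0; apply.
exact: bornology0 bI.
Qed.

End LocalFunction.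

(** * The coarse proximity of an ideal on a compact Hausdorff space *)

Section Model.
Context (T : topologicalType) (I : set (set T)) (bI : is_bornology I).
Hypotheses (cptT : compact [set: T]) (hdT : hausdorff_space T).

Local Notation lf := (local_function I).

Let bounded_lf : set (set T) := [set A | lf A = set0].

Let close_lf (A B : set T) : Prop := lf A `&` lf B !=set0.

Let bounded_lf_bornology : is_bornology bounded_lf.
Proof.
split.
- exact: local_function0.
- exact: local_function1.
- by move=> A C /(local_functionS bI) AC bC; rewrite /bounded_lf/= -subset0 -bC.
- by move=> A C; rewrite /bounded_lf/= local_functionU// => -> ->; rewrite setU0.
Qed.

Let close_lf_sym A B : close_lf A B -> close_lf B A.
Proof. by rewrite /close_lf setIC. Qed.

Let close_lf_unbounded A B : close_lf A B -> ~ bounded_lf A /\ ~ bounded_lf B.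
Proof.
by move=> [t [At Bt]]; split=> b; [move: At|move: Bt]; rewrite b.
Qed.

Let close_lf_meet A B : ~ bounded_lf (A `&` B) -> close_lf A B.
Proof.
move=> /eqP/set0P[t ABt]; exists t; split;
  apply: local_functionS bI _ _ _ _ ABt; [exact: subIsetl|exact: subIsetr].
Qed.

Let close_lfU A B C :
  close_lf (A `|` B) C <-> close_lf A C \/ close_lf B C.
Proof.
rewrite /close_lf local_functionU// setIUl; split; last first.
  by case=> -[t ht]; exists t; [left|right].
by move=> [t [|]]; [left|right]; exists t.
Qed.

(* Normality provides a closed neighbourhood [E] of B^* that misses A^*. *)
Let close_lf_strong A B : ~ close_lf A B ->
  exists E, ~ close_lf A E /\ ~ close_lf (~` E) B.
Proof.
move=> nAB.
have cB : closed (lf B) by exact: closed_local_function.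
have [|E nE cE] := @compact_normal _ hdT cptT _ cB (~` lf A).
  move=> t Bt; apply: open_nbhs_nbhs; split.
    by rewrite openC; exact: closed_local_function.
  by move=> At; apply: nAB; exists t.
exists E; split=> [[t [At /(local_function_closure bI)/cE//]]|[t [Et Bt]]].
move: Et; rewrite -[~` E]setTI -setDE.
by apply: (local_functionD bI); exact: nE.
Qed.

Definition ideal_proximity : coarse_proximity T :=
  CoarseProximity bounded_lf_bornology close_lf_sym close_lf_unbounded
    close_lf_meet close_lfU close_lf_strong.

End Model.

(** * Boundary points and points of the model *)

Section Limits.
Context (T : topologicalType) (I : set (set T)) (bI : is_bornology I).
Hypotheses (cptT : compact [set: T]) (hdT : hausdorff_space T).

Local Notation lf := (local_function I).

(** The structure of [X] is the pullback of that of [T]; this notion passes to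
    subspaces of [X] by composing [f] with the inclusion. *)
Definition modelled (X : Type) (Q : coarse_proximity X) (f : X -> T) : Prop :=
  (forall A, bounded Q A <-> lf (f @` A) = set0) /\
  (forall A B, coarse_close Q A B <-> lf (f @` A) `&` lf (f @` B) !=set0).

Lemma modelled_ideal : modelled (ideal_proximity bI cptT hdT) id.
Proof. by split=> [A|A B]; rewrite !image_id. Qed.

Lemma modelled_subspace (X : Type) (Q : coarse_proximity X) (f : X -> T)
  (Y : set X) : modelled Q f ->
  modelled (subspace_proximity Q Y) (f \o (set_val : Y -> X)).
Proof.
move=> [bQ cQ]; pose v : Y -> X := set_val.
have vE A : (f \o v) @` A = f @` (v @` A) by rewrite image_comp.
split=> [A|A B]; rewrite ?vE; last exact: cQ.
exact: iff_trans (sub_boundedE Q A) (bQ _).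
Qed.

(** The graph of the partially defined map t |-> {A | t in (f A)^*} from [T] to
    the clusters of [X]. *)
Definition lies_over (X : Type) (Q : coarse_proximity X) (f : X -> T)
  (s : smirnov Q) (t : T) : Prop := forall A, s A <-> lf (f @` A) t.

Lemma closed_nbhs_sub (t : T) (U : set T) : nbhs t U ->
  exists V, [/\ nbhs t V, closed V & V `<=` U].
Proof.
move=> /(compact_regular hdT cptT filterT)[V tV VU]; exists (closure V).
split=> //; last exact: closed_closure.
by apply: filterS tV; exact: subset_closure.
Qed.

Section OneModel.
Context (X : Type) (Q : coarse_proximity X) (f : X -> T).
Hypothesis Qf : modelled Q f.

(** The sets [A] with [t] in (f A)^* form a cluster.  Maximality is the only
    axiom that needs work: if f C is in [I] near [t], then the preimage of a
    small closed neighbourhood of [t], minus [C], is in the family but far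
    from [C]. *)
Lemma lies_over_exists t : lf (range f) t ->
  exists s : boundary Q, lies_over f (set_val s) t.
Proof.
have [bQ cQ] := Qf; move=> ft; pose m A := lf (f @` A) t.
have m0 A : m A -> A !=set0.
  move=> mA; apply/set0P/eqP => A0; move: mA.
  by rewrite /m A0 image_set0 (local_function0 bI).
have mn A B : m A -> m B -> discrete_extension Q A B.
  by move=> mA mB; right; apply/cQ; exists t.
have mm C : (forall A, m A -> discrete_extension Q C A) -> m C.
  move=> nC; apply: contrapT => /(not_local_function bI)[U oU IU].
  have [V [tV cV VU]] := closed_nbhs_sub (open_nbhs_nbhs oU).
  have mV : m (f @^-1` V `\` C).
    move=> W tW IW; apply: (ft (V `&` W)); first exact: filterI.
    apply: bornology_sub bI _ _ _ (bornologyU bI IW IU).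
    move=> _ [[x _ <-] [Vx Wx]]; have [Cx|nCx] := pselect (C x).
      by right; split; [exists x|exact: VU].
    by left; split=> //; exists x.
  have [[x [Cx [_ /(_ Cx)]]]//|/cQ[u [Cu Vu]]] := nC _ mV.
  (* [u] lies in [V], hence in the open set [U], where f C is in the ideal. *)
  have {}Vu : V u.
    rewrite (iffLR (closure_id V) cV); apply: closureS; last first.
      exact: (local_function_closure bI) Vu.
    by move=> _ [x [Vx _] <-].
  by apply: Cu IU; apply: open_nbhs_nbhs; split; [case: oU|exact: VU].
have mU A B : m (A `|` B) -> m A \/ m B.
  by rewrite /m image_setU (local_functionU bI).
pose s := Cluster m0 mn mm mU.
have sP : boundary Q s by move=> B /bQ fB; rewrite /= /m fB.
by exists (exist (fun c => c \in boundary Q) s (mem_set sP)).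
Qed.

Lemma lies_over_unique (s s' : boundary Q) t :
  lies_over f (set_val s) t -> lies_over f (set_val s') t -> s = s'.
Proof.
move=> st s't; apply: val_inj => /=.
have ext (c c' : smirnov Q) : (forall A, c A <-> c' A) -> c = c'.
  case: c c' => m m0 mn mm mU [m' m0' mn' mm' mU'] /= mm'E.
  have {}mm'E : m = m' by apply/funext => A; exact/propext.
  by subst m'; congr Cluster; exact: Prop_irrelevance.
by apply: ext => A; exact: iff_trans (st A) (iff_sym (s't A)).
Qed.

(** Openness in the boundary in terms of subsets of [X]: the complements of
    traces form a base. *)
Lemma open_boundary_far (U : set (boundary Q)) : open U ->
  forall s : boundary Q, U s -> exists A C : set X,
    [/\ set_val s A, ~ discrete_extension Q A C &
      forall s' : boundary Q, ~ (set_val s' : smirnov Q) C -> U s'].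
Proof.
move=> [O oO <-] s Os; apply: contrapT => nAC.
suff : ~ O (set_val s) by [].
apply: oO; apply/smirnov_closureP => A C sA OC.
apply: contrapT => nd; apply: nAC; exists A, C; split=> // s' nC.
by apply: contrapT => /OC.
Qed.

(** This is the preimage of [U] under the map from points of [T] to boundary
    points, which is only partially defined; [lower U] also contains the points
    of [T] over which nothing lies. *)
Definition lower (U : set (boundary Q)) : set T :=
  [set t | forall s : boundary Q, lies_over f (set_val s) t -> U s].

(** Continuity of the map from points of [T] to boundary points: if [U]
    contains all clusters that avoid [C], with [C] far from a member of [s],
    then the complement of the closed set (f C)^* is the neighbourhood. *)
Lemma lower_nbhs (U : set (boundary Q)) (s : boundary Q) t :
  open U -> U s -> lies_over f (set_val s) t -> nbhs t (lower U).
Proof.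
move=> oU Us st; have [A [C [/st At nAC CU]]] := open_boundary_far oU Us.
have : open_nbhs t (~` lf (f @` C)).
  split; first by rewrite openC; exact: closed_local_function.
  by move=> Ct; apply: nAC; right; apply/Qf.2; exists t.
move/open_nbhs_nbhs; apply: filterS => u nCu s' s'u.
by apply: CU => /s'u.
Qed.

Lemma lies_over_preimage (s : boundary Q) t (V : set T) :
  lies_over f (set_val s) t -> nbhs t V ->
  (set_val s : smirnov Q) (f @^-1` V).
Proof.
move=> st tV; apply/st.
have /st : (set_val s : smirnov Q) setT by exact: clusterT.
have /(local_functionS bI) sub :
    range f `<=` f @` (f @^-1` V) `|` (range f `\` V).
  move=> _ [a _ <-]; have [Va|nVa] := pselect (V (f a)); first by left; exists a.
  by right; split=> //; exists a.
by move=> /sub; rewrite local_functionU// => -[|/(local_functionD bI)].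
Qed.

(** A connected subset of (f X)^* maps continuously to the boundary, so a
    partition of the boundary into two open sets cannot split its image. *)
Lemma lies_over_connected (J : set T) (U V : set (boundary Q)) :
  connected J -> J `<=` lf (range f) ->
  open U -> open V -> U `&` V = set0 -> U `|` V = setT ->
  forall (x y : T) (s s' : boundary Q), J x -> J y ->
  lies_over f (set_val s) x -> lies_over f (set_val s') y -> U s -> U s'.
Proof.
move=> cJ Jf oU oV UV0 UVT x y s s' Jx Jy sx s'y Us.
have dec u : J u -> (lower U)° u \/ (lower V)° u.
  move=> /Jf/lies_over_exists[c cu].
  have : [set: boundary Q] c by [].
  by rewrite -UVT => -[Uc|Vc]; [left|right]; apply: lower_nbhs cu.
have disj u : J u -> (lower U)° u -> (lower V)° u -> False.
  move=> /Jf/lies_over_exists[c cu] /interior_subset Uu /interior_subset Vu.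
  suff : (U `&` V) c by rewrite UV0.
  by split; [exact: Uu|exact: Vu].
suff : (J `&` (lower U)°) y by move=> [_ /interior_subset Uy]; exact: Uy s'y.
suff -> : J `&` (lower U)° = J by [].
apply: cJ.
- by exists x; split=> //; exact: lower_nbhs sx.
- by exists (lower U)°; first exact: open_interior.
- exists (~` (lower V)°); first by rewrite closedC; exact: open_interior.
  apply/seteqP; split=> u [Ju].
    by move=> Uu; split=> // /(disj u Ju Uu).
  by have [|//] := dec _ Ju; split.
Qed.

Lemma traceE (A : set X) (s : boundary Q) :
  trace Q A s = (set_val s : smirnov Q) A.
Proof. by rewrite /trace /= smirnov_clE. Qed.

Lemma open_traceC (A : set X) : open (~` trace Q A).
Proof.
by rewrite openC; apply: closed_comp; [move=> ? _; exact: initial_continuous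
  |exact: closed_closure].
Qed.

End OneModel.
End Limits.

(** * The boundary of an ideal proximity *)

Section CompactBoundary.
Context (T : topologicalType) (I : set (set T)) (bI : is_bornology I).
Hypotheses (cptT : compact [set: T]) (hdT : hausdorff_space T).
Hypothesis codense : forall O, open O -> I O -> O = set0.

Local Notation lf := (local_function I).
Let P := ideal_proximity bI cptT hdT.
Local Notation over s t := (lies_over I id (set_val (s : boundary P)) t).

Lemma open_sub_local_function (O : set T) : open O -> O `<=` lf O.
Proof.
move=> oO t Ot U; rewrite nbhsE => -[V [oV Vt] VU] IU.
have : O `&` V = set0.
  apply: codense; first exact: openI.
  by apply: bornology_sub bI _ _ _ IU; exact: setIS.
by apply/eqP/set0P; exists t.
Qed.

Lemma over_inj (s : boundary P) t u : over s t -> over s u -> t = u.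
Proof.
move=> st su; apply: contrapT => /eqP tu.
have [A [oA /set_mem At /set_mem nAu]] := hausdorff_accessible hdT tu.
have [V [tV cV VA]] := closed_nbhs_sub cptT hdT (open_nbhs_nbhs (conj oA At)).
have Vt : lf V t.
  apply: (local_functionS bI (@interior_subset _ V)).
  by apply: open_sub_local_function tV; exact: open_interior.
have /st/su : lf (id @` V) t by rewrite image_id.
by rewrite image_id => /(local_function_closure bI)/cV/VA/nAu.
Qed.

Lemma over_exists t : exists s : boundary P, over s t.
Proof.
apply: lies_over_exists => //; first exact: modelled_ideal.
rewrite image_id; apply: open_sub_local_function => //; exact: openT.
Qed.

(** The sets whose complement is not in the cluster form a filter; by
    compactness it has a cluster point [t], all of whose neighbourhoods are then
    members of the cluster.  A member whose intersection with a neighbourhood of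
    [t] is bounded would be far from a smaller neighbourhood, so every member
    has [t] in its local function, and maximality gives the converse. *)
Lemma over_surj (s : boundary P) : exists t, over s t.
Proof.
have [bP cP] := modelled_ideal bI cptT hdT.
have sb : boundary P (set_val s) by exact: set_mem (valP s).
set c : smirnov P := set_val s in sb *.
pose F : set_system T := [set A | ~ c (~` A)].
have FF : ProperFilter F.
  split; first by rewrite /F/= setC0 => /(_ (clusterT c)).
  split.
  - by rewrite /F/= setCT => /cluster_neq0[].
  - by move=> A B nA nB; rewrite /F/= setCI => /clusterU[].
  - by move=> A B AB nA cB; apply: nA; apply: clusterS cB; exact: subsetC.
have [t [_ Ft]] := cptT FF filterT.
have ct U : nbhs t U -> c U.
  move=> tU; apply: contrapT => nU.
  have /Ft/(_ tU)[x []//] : F (~` U) by rewrite /F/= setCK.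
have sub A : c A -> lf A t.
  move=> cA; apply: contrapT => /(not_local_function bI)[U oU IU].
  have [V [tV cV VU]] := closed_nbhs_sub cptT hdT (open_nbhs_nbhs oU).
  have [] : c (A `&` U) \/ c (A `\` U).
  - by apply: clusterU; apply: clusterS cA => x Ax;
      have [Ux|nUx] := pselect (U x); [left|right].
  - apply: sb; apply/bP; rewrite image_id -subset0 => u /(_ setT filterT).
    by rewrite setIT.
  - move=> /cluster_near/(_ (ct _ tV))[[x [[_ nUx] /VU]]//|/cP[u]].
    rewrite !image_id => -[Au /(local_function_closure bI)/cV/VU Uu].
    apply: (local_functionD bI) Au.
    by apply: open_nbhs_nbhs; split=> //; case: oU.
exists t => A; rewrite image_id; split=> [|At]; first exact: sub.
apply: cluster_max => B /sub Bt; right; apply/cP.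
by rewrite !image_id; exists t.
Qed.

Let lift (W : set T) : set (boundary P) :=
  [set s | exists2 t, W t & over s t].

(* For a closed neighbourhood [V] of [t] inside [W], the complement of the trace
   of ~ V is a neighbourhood of the point over [t]; it is contained in [lift W]
   because the open set ~ V is included in its own local function. *)
Let open_lift W : open W -> open (lift W).
Proof.
move=> oW; rewrite openE => s [t Wt st].
have [V [tV cV VW]] := closed_nbhs_sub cptT hdT (open_nbhs_nbhs (conj oW Wt)).
apply: (@filterS _ _ _ (~` trace P (~` V))); last first.
  apply: open_nbhs_nbhs; split; first exact: open_traceC.
  rewrite /setC/= traceE => /st; rewrite image_id => /(_ _ tV).
  by rewrite setICl; apply; exact: bornology0 bI.
move=> s'; rewrite /setC/= traceE => ns'; have [t' s't'] := over_surj s'.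
exists t' => //; apply: VW; apply: contrapT => nVt'; apply: ns'.
apply/s't'; rewrite image_id; apply: open_sub_local_function nVt'.
by rewrite openC.
Qed.

Local Notation lower := (@lower T I T P id).

Let open_lower U : open U -> open (lower U).
Proof.
move=> oU; rewrite openE => t Ut; have [s st] := over_exists t.
exact: (lower_nbhs bI (modelled_ideal bI cptT hdT) oU (Ut _ st) st).
Qed.

(** Covers are carried along the bijection in both directions: pull the cover
    of the boundary back by [lower], refine it in [T], push it by [lift]. *)
Lemma boundary_covering_dim k : covering_dim_le k T ->
  covering_dim_le k (boundary P).
Proof.
move=> dimT C finC [oC covC].
have [|D [finD [oD covD] DC Dk]] := dimT (lower @` C) (finite_image _ finC).
  split=> [_ [U CU <-]|]; first exact/open_lower/oC.
  apply/seteqP; split=> // t _; have [s st] := over_exists t.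
  have : [set: boundary P] s by [].
  rewrite -covC => -[U CU Us]; exists (lower U); first by exists U.
  by move=> s' s't; rewrite (lies_over_unique s't st).
exists (lift @` D); split.
- exact: finite_image.
- split=> [_ [W DW <-]|]; first exact/open_lift/oD.
  apply/seteqP; split=> // s _; have [t st] := over_surj s.
  have : [set: T] t by [].
  by rewrite -covD => -[W DW Wt]; exists (lift W); [exists W|exists t].
- move=> _ [W DW <-]; have [_ [U CU <-] WU] := DC _ DW.
  by exists U => // s [t /WU]; exact.
- move=> s; have [t st] := over_surj s.
  apply: card_le_trans (Dk t).
  apply: card_le_trans (card_image_le lift _).
  apply: subset_card_le => _ [[W DW <-] [u Wu su]].
  by exists W => //; split=> //; rewrite (over_inj st su).
Qed.

End CompactBoundary.

(** * Infinite and finite dimensions *)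

Section LeastDimension.
Local Open Scope ereal_scope.

Lemma least_dimension_pinfty (le : nat -> Prop) :
  (forall k, ~ le k) -> least_dimension le = +oo.
Proof.
by move=> nle; apply: xgetPN => _ [k [lek _] _]; exact: nle lek.
Qed.

Lemma least_dimension_lt_pinfty (le : nat -> Prop) k :
  le k -> least_dimension le < +oo.
Proof.
move=> lek; have exk : exists k, `[< le k >] by exists k; exact/asboolP.
have [j /asboolP lej jmin] := ex_minnP exk.
rewrite /least_dimension; case: xgetP => [_ _ [i _ <-]|]; first exact: ltry.
move/(_ (j%:Z - 1)%R%:E) => []; exists j => //; split=> // i lei.
by apply: jmin; exact/asboolP.
Qed.

End LeastDimension.

(** * The ideal of nowhere dense sets *)

Definition nowhere_dense (T : topologicalType) : set (set T) :=
  [set A | (closure A)° = set0].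

Section NowhereDense.
Context (T : topologicalType).
Hypotheses (cptT : compact [set: T]) (hdT : hausdorff_space T).
Hypothesis perfT : perfect_set [set: T].

Local Notation nd := (@nowhere_dense T).
Local Notation lf := (local_function nd).

Lemma nowhere_dense_open (O A : set T) :
  nd A -> open O -> O `<=` closure A -> O = set0.
Proof.
move=> ndA oO OA; rewrite -subset0 -ndA.
by move/interior_id: oO => <-; exact: interiorS.
Qed.

Lemma nowhere_dense_bornology : is_bornology nd.
Proof.
split.
- by rewrite /nowhere_dense/= closure0 interior0.
- move=> x; rewrite /nowhere_dense/=.
  have /closure_id <- : closed [set x].
    by apply: accessible_closed_set1; exact: hausdorff_accessible.
  apply: contrapT => /eqP/set0P[y /[dup] + /interior_subset yx].
  rewrite yx => x1; apply: (iffLR perfectTP perfT x).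
  by rewrite openE => _ ->.
- move=> A C AC ndC; apply: nowhere_dense_open ndC (open_interior _) _.
  by apply: subset_trans (@interior_subset _ _) _; exact: closureS.
- move=> A C ndA ndC; set O := (closure (A `|` C))°.
  have : O `<=` closure A `|` closure C.
    by rewrite -closureU; exact: interior_subset.
  move=> OAC; apply: (nowhere_dense_open ndA); first exact: open_interior.
  (* [O] minus the closure of [A] is an open subset of the closure of [C]. *)
  rewrite -setD_eq0; apply: (nowhere_dense_open ndC).
    by apply: openI; [exact: open_interior|rewrite openC; exact: closed_closure].
  by move=> x [/OAC[]].
Qed.

Local Notation bI := nowhere_dense_bornology.

Lemma nowhere_dense_codense (O : set T) : open O -> nd O -> O = set0.
Proof.
by move=> oO ndO; apply: nowhere_dense_open ndO oO (@subset_closure _ O).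
Qed.

Lemma dense_local_function (O A : set T) :
  open O -> O `<=` closure A -> O `<=` lf A.
Proof.
move=> oO OA t Ot U; rewrite nbhsE => -[V [oV Vt] VU] ndAU.
have : O `&` V = set0; last by apply/eqP/set0P; exists t.
apply: nowhere_dense_open ndAU (openI oO oV) _ => u [Ou Vu] W uW.
have [a [Aa [Wa Va]]] := OA u Ou _ (filterI uW (open_nbhs_nbhs (conj oV Vu))).
by exists a; split=> //; split=> //; exact: VU.
Qed.

Hypothesis locally_connected : forall O : set T, open O -> O !=set0 ->
  exists J, [/\ open J, J !=set0, J `<=` O & connected J].

Lemma disjoint_closed_nbhs (J : set T) : open J -> J !=set0 ->
  exists (x y : T) (V W : set T), [/\ nbhs x V, nbhs y W, closed V /\ closed W,
    V `&` W = set0 & V `<=` J /\ W `<=` J].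
Proof.
move=> oJ J0; have [x [y [Jx Jy xy]]] := iffLR perfectTP_ex perfT J oJ J0.
move: hdT; rewrite open_hausdorff => /(_ _ _ xy)[[A B]] /=.
rewrite !inE => -[Ax By] [oA oB AB0].
have cl (U : set T) z : open U -> U z -> J z ->
    exists V, [/\ nbhs z V, closed V & V `<=` U `&` J].
  move=> oU Uz Jz; apply: closed_nbhs_sub => //.
  by apply: open_nbhs_nbhs; split=> //; exact: openI.
have [V [xV cV VA]] := cl _ _ oA Ax Jx; have [W [yW cW WB]] := cl _ _ oB By Jy.
exists x, y, V, W; split=> //; last by split=> z => [/VA[]|/WB[]].
by rewrite -subset0 -AB0 => z [/VA[? _] /WB[? _]].
Qed.

(** An unbounded [X] is dense, via [f], in a nonempty connected open set [J].
    The preimages of two disjoint closed neighbourhoods [V] and [W] of points of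
    [J] are not close.  If a separator [C] between them were bounded, its trace
    would be empty, so that the boundary would split into two open parts, one of
    which contains the trace for [V] and the other the trace for [W], although
    [J] is connected.  So [C] is unbounded, and the induction hypothesis applies
    to it. *)
Lemma not_asInd_le k : forall (X : Type) (Q : coarse_proximity X) (f : X -> T),
  modelled nd Q f -> ~ bounded Q setT -> ~ asInd_le k Q.
Proof.
elim: k => [//|k IH] X Q f Qf ubQ Qk.
have [bQ cQ] := Qf.
have [t ft] : lf (range f) !=set0.
  by apply/set0P/eqP => f0; apply: ubQ; exact/bQ.
have [J [oJ J0 Jf conJ]] : exists J, [/\ open J, J !=set0,
    J `<=` (closure (range f))° & connected J].
  apply: locally_connected; first exact: open_interior.
  apply/set0P/eqP => f0; apply: (ft setT); first exact: filterT.
  by rewrite setIT.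
have Jlf : J `<=` lf (range f).
  apply: dense_local_function => //.
  exact: subset_trans Jf (@interior_subset _ _).
have [x [y [V [W [xV yW [cV cW] VW0 [VJ WJ]]]]]] := disjoint_closed_nbhs oJ J0.
have lfsub (Z : set T) : closed Z -> lf (f @` (f @^-1` Z)) `<=` Z.
  move=> cZ; apply: (subset_trans (local_function_closure bI (A := _))).
  rewrite [X in _ `<=` X](iffLR (closure_id Z) cZ).
  by apply: closureS => _ [a Za <-].
have [|C [[U1 [U2 [oU1 oU2 U12 CU [AU1 BU2]]]] Ck]] :=
    Qk (f @^-1` V) (f @^-1` W).
  move=> /cQ[u [/(lfsub _ cV) Vu /(lfsub _ cW) Wu]].
  by suff : (V `&` W) u by rewrite VW0.
have bC : bounded Q C.
  apply: contrapT => ubC; apply: IH Ck; first exact: modelled_subspace Qf.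
  move=> /sub_boundedE bC; apply: ubC.
  apply: bornology_sub (bounded_bornology Q) _ _ _ bC => c Cc.
  by exists (exist _ c (mem_set Cc)).
have U12T : U1 `|` U2 = setT.
  rewrite -CU; apply/seteqP; split=> // s _; rewrite /setC/= traceE.
  have sb : boundary Q (set_val s) by exact: set_mem (valP s).
  exact: sb.
have [Jx Jy] : J x /\ J y.
  by split; [apply: VJ|apply: WJ]; apply: nbhs_singleton.
have [s sx] := lies_over_exists bI cptT hdT Qf (Jlf _ Jx).
have [s' s'y] := lies_over_exists bI cptT hdT Qf (Jlf _ Jy).
have U1s : U1 s.
  by apply: AU1; rewrite traceE; exact: (lies_over_preimage bI sx xV).
have U2s' : U2 s'.
  by apply: BU2; rewrite traceE; exact: (lies_over_preimage bI s'y yW).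
suff : (U1 `&` U2) s' by rewrite U12.
split=> //.
exact: (lies_over_connected bI cptT hdT Qf conJ Jlf oU1 oU2 U12 U12T Jx Jy sx).
Qed.

Theorem asInd_nowhere_dense : [set: T] !=set0 ->
  asInd (ideal_proximity bI cptT hdT) = +oo%E.
Proof.
move=> [t _]; apply: least_dimension_pinfty => k.
apply: (not_asInd_le (modelled_ideal bI cptT hdT)).
move=> /=; rewrite -subset0 => /(_ t); apply.
by apply: (open_sub_local_function bI nowhere_dense_codense openT).
Qed.

End NowhereDense.

(** * The unit interval *)

Import numFieldNormedType.Exports.
Local Open Scope ring_scope.

Section UnitInterval.
Context (R : realType).

Definition unit_interval : set R := `[0, 1].

Local Notation T := (set_type unit_interval).

Lemma unit_intervalP (t : T) : 0 <= (set_val t : R) <= 1.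
Proof. by have := set_mem (valP t); rewrite /unit_interval/= in_itv. Qed.

Let clamp_in (x : R) : Num.max 0 (Num.min 1 x) \in unit_interval.
Proof.
apply/mem_set; rewrite /unit_interval/= in_itv/=.
by rewrite le_max lexx/= ge_max ler01 ge_min lexx.
Qed.

(** A retraction of the line onto the unit interval, through which compactness
    and connectedness are inherited from segments and intervals. *)
Definition clamp (x : R) : T :=
  exist (fun x => x \in unit_interval) _ (clamp_in x).

Lemma clampK (x : R) : 0 <= x <= 1 -> set_val (clamp x) = x.
Proof.
by move=> /andP[x0 x1]; rewrite set_valE/= (min_idPr x1) (max_idPr x0).
Qed.

Lemma set_valK (t : T) : clamp (set_val t) = t.
Proof. by apply/val_inj/clampK/unit_intervalP. Qed.

Lemma continuous_clamp : continuous clamp.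
Proof.
apply: continuous_comp_initial => x.
apply: continuous_max; first exact: cvg_cst.
by apply: continuous_min; [exact: cvg_cst|exact: cvg_id].
Qed.

Lemma image_clamp (U : set T) : clamp @` (set_val @` U) = U.
Proof.
apply/seteqP; split=> [_ [_ [t Ut <-] <-]|t Ut]; first by rewrite set_valK.
by exists (set_val t); [exists t|exact: set_valK].
Qed.

Lemma range_set_val : set_val @` [set: T] = unit_interval.
Proof.
apply/seteqP; split=> [_ [t _ <-]|x]; rewrite /unit_interval/= in_itv/=.
  exact: unit_intervalP.
by move=> x01; exists (clamp x) => //; exact: clampK.
Qed.

Lemma unit_interval_compact : compact [set: T].
Proof.
rewrite -[setT]image_clamp range_set_val; apply: continuous_compact.
  by apply: continuous_subspaceT; exact: continuous_clamp.
exact: segment_compact.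
Qed.

Lemma unit_interval_hausdorff : hausdorff_space T.
Proof.
move=> s t st; apply: val_inj; apply: (@Rhausdorff R) => A B sA tB.
have sA' : nbhs s (set_val @^-1` A) by exact: initial_continuous.
have tB' : nbhs t (set_val @^-1` B) by exact: initial_continuous.
have [u [Au Bu]] := st _ _ sA' tB'.
by exists (set_val u).
Qed.

Lemma unit_interval_connected (J : set R) : is_interval J ->
  connected (set_val @^-1` J : set T).
Proof.
move=> iJ; rewrite -[_ @^-1` _]image_clamp.
apply: connected_continuous_connected.
  apply/connected_intervalP.
  move=> _ _ [s Js <-] [t Jt <-] z szt.
  have z01 : 0 <= z <= 1.
    have /andP[s0 _] := unit_intervalP s; have /andP[_ t1] := unit_intervalP t.
    case/andP: szt => sz zt.
    by rewrite (le_trans s0 sz) (le_trans zt t1).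
  exists (clamp z); last exact: clampK.
  by rewrite /preimage/= clampK//; exact: iJ Js Jt _ szt.
by apply: continuous_subspaceT; exact: continuous_clamp.
Qed.

(** An isolated point would be a nonempty clopen set, hence everything, but the
    endpoints are distinct. *)
Lemma unit_interval_perfect : perfect_set [set: T].
Proof.
apply/perfectTP => t ot.
have ct : closed [set t].
  exact/accessible_closed_set1/hausdorff_accessible/unit_interval_hausdorff.
have : [set t] = [set: T].
  have := @unit_interval_connected setT; rewrite preimage_setT; apply.
  - by move=> ? ? _ _ ? _.
  - by exists t.
  - by exists [set t] => //; rewrite setTI.
  - by exists [set t] => //; rewrite setTI.
move=> tT; have eqt x : 0 <= x <= 1 -> x = set_val t.
  move=> x01; have : [set: T] (clamp x) by [].
  by rewrite -tT => <-; rewrite clampK.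
have /eqP : 0 = 1 :> R by rewrite (eqt 0) ?lexx ?ler01// -(eqt 1)// ler01 lexx.
by rewrite eq_sym oner_eq0.
Qed.

Lemma unit_interval_locally_connected (O : set T) : open O -> O !=set0 ->
  exists J, [/\ open J, J !=set0, J `<=` O & connected J].
Proof.
move=> [U oU <-] [t Ut].
have [e /= e0 eU] := iffLR (nbhs_ballP _ _) (open_nbhs_nbhs (conj oU Ut)).
exists (set_val @^-1` ball (set_val t : R) e); split.
- apply: open_comp; last exact: ball_open.
  by move=> ? _; exact: initial_continuous.
- by exists t; exact: ballxx.
- by move=> s /eU.
- apply: unit_interval_connected; rewrite ball_itv; exact: interval_is_interval.
Qed.

Lemma unit_interval_lebesgue_number (C : set (set T)) : open_cover C ->
  exists n : nat, forall t : T, exists2 W, C W &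
    forall s : T, `|set_val t - set_val s : R| < n.+1%:R^-1 -> W s.
Proof.
move=> [oC covC].
have /compact_near_coveringP/(_ nat \oo (fun n t => exists2 W, C W &
    forall s : T, `|set_val t - set_val s : R| < n.+1%:R^-1 -> W s)) :=
  unit_interval_compact.
case=> [t _|n _ Cn]; last by exists n => t; exact: (Cn n (leqnn n) t I).
have : [set: T] t by [].
rewrite -covC => -[W CW Wt]; have [U oU UW] := oC _ CW.
have {}Ut : U (set_val t) by move: Wt; rewrite -UW.
have [e /= e0 eU] := iffLR (nbhs_ballP _ _) (open_nbhs_nbhs (conj oU Ut)).
have e20 : 0 < e / 2 by rewrite divr_gt0.
near=> t' n => /=; exists W => // s t's; rewrite -UW; apply: eU.
rewrite /ball/= [e]splitr -[_ - _](subrKA (set_val t')).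
apply: le_lt_trans (ler_normD _ _) _; apply: ltrD.
  near: t'; have : nbhs (set_val t : R) (ball (set_val t : R) (e / 2)).
    exact: nbhsx_ballx.
  exact: initial_continuous.
apply: lt_trans t's _; near: n; exact: (near_infty_natSinv_lt (PosNum e20)).
Unshelve. all: by end_near. Qed.

(** The cover by the relative balls of radius 1/n around the multiples of 1/n
    has order 2, and refines any given cover for [n] large by the Lebesgue
    number lemma. *)
Lemma unit_interval_covering_dim : covering_dim_le 2 T.
Proof.
move=> C finC covC; have [N CN] := unit_interval_lebesgue_number covC.
pose n := N.+1; have n0 : 0 < n%:R :> R by rewrite ltr0n.
pose O (i : nat) : set T := [set s | `|i%:R - set_val s * n%:R : R| < 1].
have oO i : open (O i).
  pose f (s : T) : R := i%:R - set_val s * n%:R.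
  have -> : O i = f @^-1` ball 0 1.
    by apply/seteqP; split=> s; rewrite /O/f/ball/= sub0r normrN.
  have oB : open (ball 0 1 : set R) by exact: ball_open.
  apply: open_comp oB => s _.
  have vs : (set_val : T -> R) x @[x --> s] --> (set_val s : R).
    exact: initial_continuous.
  exact: cvgB (cvg_cst _) (cvgM vs (cvg_cst _)).
have xn_ge0 (t : T) : 0 <= set_val t * n%:R :> R.
  by rewrite mulr_ge0 ?ler0n//; have /andP[] := unit_intervalP t.
exists (O @` `I_n.+1); split.
- exact/finite_image/finite_II.
- split=> [_ [i _ <-]//|]; apply/seteqP; split=> // t _.
  have /andP[mt tm] := truncn_itv (xn_ge0 t).
  exists (O (Num.truncn (set_val t * n%:R : R))).
    exists (Num.truncn (set_val t * n%:R : R)) => //=.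
    rewrite ltnS -(ler_nat R); apply: le_trans mt _.
    by rewrite ler_piMl ?ler0n//; have /andP[] := unit_intervalP t.
  rewrite /O/= distrC ger0_norm ?subr_ge0// ltrBlDl.
  by rewrite natr1.
- move=> _ [i /= iin <-].
  have [W CW WP] := CN (clamp (i%:R / n%:R)).
  exists W => // s; rewrite /O/= => si; apply: WP; rewrite clampK.
    rewrite -(ltr_pM2r n0) mulVf ?gt_eqF// -[X in _ * X]gtr0_norm// -normrM.
    by rewrite mulrBl divfK// gt_eqF.
  by rewrite divr_ge0 ?ler0n//= ler_pdivrMr// mul1r ler_nat -ltnS.
- move=> t; set m := Num.truncn (set_val t * n%:R : R).
  have /andP[mt tm] := truncn_itv (xn_ge0 t).
  (* With m <= t n < m + 1, only the balls with centres m/n and (m + 1)/n can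
     contain [t]. *)
  apply: card_le_trans (card_image_le (fun j => O (m + j)%N) `I_2).
  apply: subset_card_le => _ [[i /= iin <-]]; rewrite /O/= ltr_distlC.
  move=> /andP[it ti].
  have mi : (m <= i)%N.
    by rewrite -ltnS -(ltr_nat R) -natr1; exact: le_lt_trans mt ti.
  exists (i - m)%N => /=; last by rewrite subnKC.
  rewrite ltn_subLR// addn2 -(ltr_nat R) -[m.+2%:R]natr1 -ltrBlDr.
  exact: lt_trans it tm.
Qed.

End UnitInterval.

Arguments unit_interval : clear implicits.

Theorem corollary3p14 :
  exists (X : Type) (P : coarse_proximity X),
    (covering_dim (boundary P) < asInd P)%E.
Proof.
pose R : realType := Rdefinitions.R.
pose T : topologicalType := unit_interval R.
have cT : compact [set: T] := @unit_interval_compact R.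
have hT : hausdorff_space T := @unit_interval_hausdorff R.
have pT : perfect_set [set: T] := @unit_interval_perfect R.
exists T, (ideal_proximity (nowhere_dense_bornology hT pT) cT hT).
set P := ideal_proximity _ _ _.
have -> : asInd P = +oo%E.
  apply: asInd_nowhere_dense; first exact: unit_interval_locally_connected.
  by exists (clamp (0 : R)).
apply: (@least_dimension_lt_pinfty _ 2); apply: boundary_covering_dim.
  exact: nowhere_dense_codense.
exact: unit_interval_covering_dim.
Qed.
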